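(* The minimum number of detours in a connected graph of minimum degree at least $2$ and order at least $4$ is $4$. That is, writing $f(G)$ for the number of detours of a graph $G$, the minimum of $f(G)$ over all connected finite simple graphs $G$ with $\delta(G)\ge 2$ and $|V(G)|\ge 4$ equals $4$: every such graph satisfies $f(G)\ge 4$, and there exists such a graph with $f(G)=4$.
   Context: All graphs are finite and simple. The order of a graph is its number of vertices, and $\delta(G)$ denotes the minimum degree of $G$. A detour of a graph $G$ is a longest path in $G$, i.e. a path of $G$ with the maximum possible number of vertices among all paths in $G$. Paths are regarded as subgraphs (so a path and its reversal are the same path), and $f(G)$ denotes the number of distinct detours in $G$. *)

(* Defs.v *)
From mathcomp Require Import all_boot.

Set Implicit Arguments.
Unset Strict Implicit.
Unset Printing Implicit Defensive.

Record sgraph := SGraph {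
  vertex :> finType;
  adj : rel vertex;
  adj_sym : symmetric adj;
  adj_irrefl : irreflexive adj
}.

Section Graph.
Variable G : sgraph.

Definition connected : Prop :=
  0 < #|G| /\ forall x y : G, connect (@adj G) x y.

Definition degree (x : G) : nat := #|[set y | adj x y]|.

(* Every degree is less than #|G|, so the default value #|G| of the iterated
   minimum has no effect unless G has no vertices. *)
Definition min_degree : nat := \big[minn/#|G|]_(x : G) degree x.

(* A subgraph is encoded by its vertex set and its edge set, an edge being an
   unordered pair of vertices.  The subgraph traced by a sequence of vertices
   is the same for the sequence and its reversal. *)
Definition traced_subgraph (s : seq G) : {set G} * {set {set G}} :=
  ([set x in s], [set [set p.1; p.2] | p in zip s (behead s)]).

(* The paths of G with exactly n vertices, as subgraphs of G. *)
Definition paths (n : nat) : {set {set G} * {set {set G}}} :=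
  [set traced_subgraph t | t : n.-tuple G & uniq t && sorted (@adj G) t].

Definition detour_order : nat := \max_(n < #|G|.+1 | paths n != set0) n.

Definition detours : {set {set G} * {set {set G}}} := paths detour_order.

Definition num_detours : nat := #|detours|.

End Graph.

(* Main.v *)
(** Let [v_1 ... v_k] be a detour.  All neighbours of [v_1] and of [v_k] lie on
    it, so [v_1 ~ v_i] with [i >= 3] and [v_k ~ v_j] with [j <= k - 2].  If some
    detour closes up to a cycle, then this cycle spans [G], and deleting any one
    of its at least four edges gives a detour.  Otherwise, write [e] for
    [v_1 v_i] and [f] for [v_j v_k].  The detour itself contains neither [e] nor
    [f], and rotating it (replacing [v_(i-1) v_i] by [e], or [v_j v_(j+1)] by
    [f]) gives one containing [e] only and one containing [f] only.  A detour
    containing both is obtained by performing both rotations if [i <= j], and is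
    [v_(j-1) ... v_1 v_i v_(i-1) ... v_j v_k ... v_(i+1)] if [i >= j + 2]; if
    [i = j + 1], the first rotated detour closes up to a cycle. *)

Require Import Defs.
From mathcomp Require Import all_boot.

Set Implicit Arguments.
Unset Strict Implicit.
Unset Printing Implicit Defensive.

(** * Edge sets traced by vertex sequences *)

Lemma set2_inj (T : finType) (a b c d : T) :
  [set a; b] = [set c; d] -> (a = c /\ b = d) \/ (a = d /\ b = c).
Proof.
move=> eq_ab.
have /set2P a_cd : a \in [set c; d] by rewrite -eq_ab set21.
have /set2P b_cd : b \in [set c; d] by rewrite -eq_ab set22.
have /set2P c_ab : c \in [set a; b] by rewrite eq_ab set21.
have /set2P d_ab : d \in [set a; b] by rewrite eq_ab set22.
by case: a_cd b_cd c_ab d_ab => -> [] -> [] ? [] ?; subst; auto.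
Qed.

Section TracedEdges.
Variable G : sgraph.
Implicit Types (a b c : G) (s : seq G).

Definition traced_edges s : {set {set G}} := (traced_subgraph s).2.

Lemma traced_edgesE s : traced_edges s = [set [set p.1; p.2] | p in zip s (behead s)].
Proof. by []. Qed.

Lemma traced_edges_cons2 a b s :
  traced_edges [:: a, b & s] = [set a; b] |: traced_edges (b :: s).
Proof.
apply/setP=> E; rewrite !traced_edgesE in_setU1.
apply/imsetP/orP => [[p]|[/eqP->|/imsetP[p p_in ->]]].
- rewrite /= inE => /orP[/eqP-> ->|p_in ->]; first by left.
  by right; apply/imsetP; exists p.
- by exists (a, b); rewrite //= inE eqxx.
- by exists p; rewrite //= inE p_in orbT.
Qed.

Lemma traced_edges_small s : size s <= 1 -> traced_edges s = set0.
Proof.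
by case: s => [|a []] // _; apply/setP=> E; rewrite traced_edgesE in_set0; apply/imsetP=> -[].
Qed.

(** The cut vertex [a] belongs to both pieces, so the edge leading into it is kept. *)
Lemma traced_edges_cat s1 a s2 :
  traced_edges (s1 ++ a :: s2) = traced_edges (rcons s1 a) :|: traced_edges (a :: s2).
Proof.
elim: s1 => [|b [|c s1] IH]; first by rewrite [traced_edges (rcons _ _)]traced_edges_small // set0U.
  by rewrite /= !traced_edges_cons2 [traced_edges [:: a]]traced_edges_small // setU0.
by move: IH; rewrite /= !traced_edges_cons2 -setUA => <-.
Qed.

Lemma traced_edges_rev s : traced_edges (rev s) = traced_edges s.
Proof.
elim: s => [|a [|b s] IH] //.
rewrite 2!rev_cons -cats1 cat_rcons traced_edges_cat -rev_cons IH.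
by rewrite !traced_edges_cons2 [traced_edges [:: a]]traced_edges_small // setU0 setUC [[set b; a]]setUC.
Qed.

Lemma traced_subgraph_rev s : traced_subgraph (rev s) = traced_subgraph s.
Proof.
apply/eqP; rewrite xpair_eqE; apply/andP; split; apply/eqP; last exact: traced_edges_rev.
by apply/setP=> x; rewrite !inE mem_rev.
Qed.

Lemma mem_traced_edges s1 a b s2 : [set a; b] \in traced_edges (s1 ++ [:: a, b & s2]).
Proof. by rewrite traced_edges_cat traced_edges_cons2 !inE eqxx orbT. Qed.

Lemma traced_edges_sub s a b : [set a; b] \in traced_edges s -> (a \in s) && (b \in s).
Proof.
elim: s => [|c s IH]; first by rewrite traced_edges_small // in_set0.
case: s IH => [|d s] IH; first by rewrite traced_edges_small // in_set0.
rewrite traced_edges_cons2 in_setU1 => /orP[/eqP/set2_inj|/IH/andP[a_in b_in]].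
  by case=> -[-> ->]; rewrite !inE !eqxx ?orbT.
by move: a_in b_in; rewrite !inE => -> ->; rewrite !orbT.
Qed.

(** An end vertex of a path lies on a single path edge, the one to its successor. If [s] is empty
    there is no edge at all. *)
Lemma traced_edges_head a b s :
  uniq (a :: s) -> head a s != b -> [set a; b] \notin traced_edges (a :: s).
Proof.
case: s => [|c s]; first by rewrite traced_edges_small // in_set0.
rewrite cons_uniq => /andP[a_notin _] neq_cb.
rewrite traced_edges_cons2 in_setU1 negb_or; apply/andP; split.
  apply/eqP=> /set2_inj[[_ eq_bc]|[eq_ac _]]; first by rewrite eq_bc eqxx in neq_cb.
  by rewrite eq_ac mem_head in a_notin.
by apply/negP=> /traced_edges_sub/andP[]; rewrite (negPf a_notin).
Qed.

Lemma traced_edges_last a b s :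
  uniq (rcons s a) -> last a s != b -> [set b; a] \notin traced_edges (rcons s a).
Proof.
rewrite -rev_uniq -traced_edges_rev setUC rev_rcons => s_uniq neq_b.
apply: traced_edges_head => //.
by case/lastP: s {s_uniq} neq_b => // s c; rewrite last_rcons rev_rcons.
Qed.

End TracedEdges.

(** * Detours as vertex sequences, and their rotations *)

Section Detours.
Variable G : sgraph.
Implicit Types (a b c : G) (s : seq G).

Definition path_seq s := uniq s && sorted (@adj G) s.

Definition detour_seq s := path_seq s && (size s == detour_order G).

Lemma mem_paths s : path_seq s -> traced_subgraph s \in paths G (size s).
Proof. by move=> s_path; apply/imsetP; exists (in_tuple s); rewrite ?inE. Qed.

Lemma leq_detour_order s : path_seq s -> size s <= detour_order G.
Proof.
move=> s_path; have lt_sG : size s < #|G|.+1.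
  by case/andP: s_path => /card_uniqP <- _; rewrite ltnS max_card.
apply: (@leq_bigmax_cond _ _ (fun n : 'I__ => n : nat) (Ordinal lt_sG)).
by apply/set0Pn; exists (traced_subgraph s); apply: mem_paths.
Qed.

Lemma mem_detours s : detour_seq s -> traced_subgraph s \in detours G.
Proof. by case/andP=> s_path /eqP s_size; rewrite /detours -s_size mem_paths. Qed.

(** The maximum is attained because the empty sequence makes length 0 admissible. *)
Lemma detour_seq_exists : exists s, detour_seq s.
Proof.
have nil_path : paths G (@ord0 #|G|) != set0.
  by apply/set0Pn; exists (traced_subgraph [::]); apply: (@mem_paths [::]).
have [|n n_path n_max] := @eq_bigmax_cond _ (fun n : 'I_(#|G|.+1) => paths G n != set0)
  (fun n => n : nat); first by apply/card_gt0P; exists ord0.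
have /set0Pn[_ /imsetP[t t_path _]] : paths G n != set0 by [].
exists t; rewrite /detour_seq size_tuple.
rewrite inE in t_path; apply/andP; split=> //.
by apply/eqP; rewrite -n_max.
Qed.

Lemma path_seq_rev s : path_seq (rev s) = path_seq s.
Proof.
rewrite /path_seq rev_uniq rev_sorted; congr (_ && _).
by apply: eq_sorted => x y; apply: adj_sym.
Qed.

Lemma detour_seq_rev s : detour_seq (rev s) = detour_seq s.
Proof. by rewrite /detour_seq path_seq_rev size_rev. Qed.

(** Rotation at the first vertex: the edge into [b] is exchanged for the edge from [a] to [b], and
    the vertices stay the same. *)
Lemma detour_seq_rotl a s b s' :
  detour_seq ((a :: s) ++ b :: s') -> adj a b -> detour_seq (rev (a :: s) ++ b :: s').
Proof.
rewrite /detour_seq /path_seq !size_cat size_rev => /andP[/andP[u p] ->] ab.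
rewrite andbT; apply/andP; split.
  by rewrite -(@perm_uniq _ ((a :: s) ++ b :: s')) // perm_cat2r perm_sym perm_rev.
move: p; rewrite /= cat_path /= => /and3P[p _ p'].
have: sorted (@adj G) (rev (a :: s)).
  by rewrite rev_sorted (eq_sorted (e' := @adj G)) // => x y; apply: adj_sym.
rewrite rev_cons; case: (rev s) => [|c r] /=; first by rewrite ab p'.
by rewrite cat_path /= last_rcons ab p' => ->.
Qed.

Lemma detour_seq_rotr s a s' b :
  detour_seq (rcons s a ++ rcons s' b) -> adj a b ->
  detour_seq (rcons s a ++ rev (rcons s' b)).
Proof.
rewrite -detour_seq_rev rev_cat !rev_rcons => det ab.
rewrite -detour_seq_rev rev_cat [rev (rcons s a)]rev_rcons.
by apply: detour_seq_rotl; rewrite // adj_sym.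
Qed.

(** * Counting detours, and the case of a detour that closes up *)

(** Sequences whose edge sets differ in some invariant [phi] trace different subgraphs, so reversals
    need no separate care. In the applications [phi] records which of a few chosen edges are
    present. *)
Lemma num_detours_ge (T : eqType) (phi : {set {set G}} -> T) (ss : seq (seq G)) :
  all detour_seq ss -> uniq [seq phi (traced_edges s) | s <- ss] ->
  size ss <= num_detours G.
Proof.
move=> /allP det.
rewrite -(@eq_map _ _ ((fun S => phi S.2) \o @traced_subgraph G)) // map_comp => /map_uniq u.
rewrite -(size_map (@traced_subgraph G) ss) -(card_uniqP u).
apply/subset_leq_card/subsetP=> S /mapP[s s_in ->].
by apply/mem_detours/det.
Qed.

Lemma num_detours_cycle x s : connected G -> 4 <= #|G| ->
  detour_seq (x :: s) -> adj (last x s) x -> 4 <= num_detours G.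
Proof.
move=> [_ G_conn] G_ge4 det.
have /andP[/andP[s_uniq s_sorted] /eqP s_size] := det => closed_up.
have cyc : cycle (@adj G) (x :: s) by rewrite /= rcons_path; apply/andP.
have det_rot i : detour_seq (rot i (x :: s)).
  rewrite /detour_seq /path_seq rot_uniq s_uniq size_rot s_size eqxx andbT.
  have: cycle (@adj G) (rot i (x :: s)) by rewrite rot_cycle.
  by case: (rot i _) => //= a r; rewrite rcons_path => /andP[].
(* A neighbour [b] of a cycle vertex [a], lying off the cycle, could be put in front of the rotation
   starting at [a], giving a path longer than a detour. *)
have s_closed : closed (@adj G) (mem (x :: s)).
  apply: intro_closed; first exact/sym_connect_sym/adj_sym.
  move=> a b ab a_s; apply/negPn/negP=> b_notin.
  have [i r def_r] := rot_to a_s.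
  have : path_seq (b :: rot i (x :: s)).
    have /andP[/andP[u p] _] := det_rot i.
    rewrite /path_seq cons_uniq mem_rot b_notin u.
    by move: p; rewrite def_r /= adj_sym ab.
  by move/leq_detour_order; rewrite [size (_ :: _)]/= size_rot s_size ltnn.
have s_ge4 : 4 <= size (x :: s).
  apply: leq_trans G_ge4 _; rewrite -(card_uniqP s_uniq).
  apply/subset_leq_card/subsetP=> b _.
  by rewrite -(closed_connect s_closed (G_conn x b)) mem_head.
move: (x :: s) s_ge4 s_uniq det_rot => [|a [|b [|c [|d t]]]] // _ u det_rot.
(* Three edges tell four rotations apart: the rotations by 1, 2 and 3 each omit exactly one of them,
   while the unrotated sequence omits only the closing edge. *)
pose phi (F : {set {set G}}) := ([set a; b] \in F, [set b; c] \in F, [set c; d] \in F).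
apply: (@num_detours_ge _ phi [seq rot i [:: a, b, c, d & t] | i <- iota 0 4]).
  by apply/allP=> _ /mapP[i _ ->].
have u1 : uniq (rot 1 [:: a, b, c, d & t]) by rewrite rot_uniq.
have u2 : uniq (rot 2 [:: a, b, c, d & t]) by rewrite rot_uniq.
have u3 : uniq (rot 3 [:: a, b, c, d & t]) by rewrite rot_uniq.
have [neq_ac neq_bd] : c != a /\ d != b.
  by move: u; rewrite /= !inE !negb_or => /and3P[/and3P[_ ? _] /and3P[_ ? _] _]; rewrite !(eq_sym _ a) !(eq_sym _ b).
have phi0 : phi (traced_edges [:: a, b, c, d & t]) = (true, true, true).
  by rewrite /phi (mem_traced_edges [::]) (mem_traced_edges [:: a]) (mem_traced_edges [:: a; b]).
have phi1 : phi (traced_edges [:: b, c, d & t ++ [:: a]]) = (false, true, true).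
  rewrite /phi (mem_traced_edges [::]) (mem_traced_edges [:: b]).
  by rewrite setUC (negPf (traced_edges_head u1 neq_ac)).
have phi2 : phi (traced_edges [:: c, d & t ++ [:: a; b]]) = (true, false, true).
  rewrite /phi (mem_traced_edges [::]) (mem_traced_edges [:: c, d & t]).
  by rewrite [[set b; c]]setUC (negPf (traced_edges_head u2 neq_bd)).
have phi3 : phi (traced_edges (d :: t ++ [:: a; b; c])) = (true, true, false).
  rewrite /phi (mem_traced_edges (d :: t)) -[t ++ _]/(t ++ [:: a] ++ [:: b; c]) catA.
  rewrite (mem_traced_edges (d :: _)) [[set c; d]]setUC.
  have def3 : rot 3 [:: a, b, c, d & t] = rcons (d :: t ++ [:: a; b]) c.
    by rewrite /rot /= -cats1 -catA.
  rewrite def3 in u3; have -> : d :: (t ++ [:: a]) ++ [:: b; c] = rcons (d :: t ++ [:: a; b]) c.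
    by rewrite /= -cats1 -!catA.
  by rewrite (negPf (traced_edges_last u3 _)) //= last_cat /= eq_sym.
by rewrite /= /rot /= cats0 phi0 phi1 phi2 phi3.
Qed.

(** * Chords at the ends of a detour *)

Lemma min_degree_leq a : min_degree G <= degree a.
Proof.
rewrite /min_degree; elim: (index_enum G) (mem_index_enum a) => // b r IH.
rewrite big_cons inE => /orP[/eqP->|/IH le_r]; first exact: geq_minl.
exact: leq_trans (geq_minr _ _) le_r.
Qed.

Lemma exists_neighbor a b : 2 <= min_degree G -> exists2 c, adj a c & c != b.
Proof.
move=> deg; have := leq_trans deg (min_degree_leq a).
rewrite /degree (cardsD1 b) => lt1.
have /card_gt0P[c] : 0 < #|[set y | adj a y] :\ b|.
  by move: lt1; case: (b \in _); rewrite //= add0n => /ltnW.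
by rewrite !inE => /andP[cb ac]; exists c.
Qed.

(** The first vertex has a neighbour other than its successor, and by maximality that neighbour is
    on the detour. Displaying [c] between [a] and [b] records that it is not the successor. *)
Lemma detour_seq_chord s : 2 <= min_degree G -> 0 < #|G| -> detour_seq s ->
  exists a c s1 b s2, s = [:: a, c & s1] ++ b :: s2 /\ adj a b.
Proof.
move=> deg /card_gt0P[a0 _]; case: s => [/andP[_ /eqP/= k0]|a s det].
  by have := @leq_detour_order [:: a0] isT; rewrite -k0.
have [b ab neq_b] := exists_neighbor a (head a s) deg.
have /andP[/andP[u p] /eqP k] := det.
have : b \in a :: s.
  apply/negPn/negP=> b_notin.
  have: path_seq (b :: a :: s) by rewrite /path_seq cons_uniq b_notin u /= adj_sym ab.
  by move/leq_detour_order; rewrite -k ltnn.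
rewrite inE => /orP[/eqP ba|b_s]; first by rewrite ba adj_irrefl in ab.
case: s neq_b b_s {det u p k} => [|c s] //= neq_b; rewrite inE (negPf neq_b) /=.
by case/splitPr=> s1 s2; exists a, c, s1, b, s2.
Qed.

(** This serves to compare the positions of the inner ends of the two chords. *)
Lemma cat_eq_cases (T : Type) (s1 s2 t1 t2 : seq T) : s1 ++ s2 = t1 ++ t2 ->
  (exists r, t1 = s1 ++ r /\ s2 = r ++ t2) \/ (exists r, s1 = t1 ++ r /\ t2 = r ++ s2).
Proof.
elim: s1 t1 => [|x s1 IH] [|y t1] /=.
- by move=> ->; left; exists [::].
- by move=> ->; left; exists (y :: t1).
- by move=> <-; right; exists (x :: s1).
by case=> -> /IH[] [r [-> ->]]; [left|right]; exists r.
Qed.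

(** * Four detours from two chords *)

Lemma num_detours_ge4_of_edges (e f : {set G}) s s_e s_f s_ef :
  all detour_seq [:: s; s_e; s_f; s_ef] ->
  e \notin traced_edges s -> f \notin traced_edges s ->
  e \in traced_edges s_e -> f \notin traced_edges s_e ->
  e \notin traced_edges s_f -> f \in traced_edges s_f ->
  e \in traced_edges s_ef -> f \in traced_edges s_ef ->
  4 <= num_detours G.
Proof.
move=> det /negPf e0 /negPf f0 e1 /negPf f1 /negPf e2 f2 e3 f3.
apply: (@num_detours_ge _ (fun F => (e \in F, f \in F)) [:: s; s_e; s_f; s_ef]) => //=.
by rewrite e0 f0 e1 f1 e2 f2 e3 f3.
Qed.

(** This is the case [i <= j], with [b] and [w] possibly equal. Both rotations leave the block
    [b :: r] in place, so they can be performed independently. The defaults in [head b s] and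
    [last w t] make the inequalities exclude empty [s] and [t]. *)
Lemma num_detours_disjoint_chords a s b r w t v :
  detour_seq ((a :: s) ++ (b :: r) ++ rcons t v) -> last b r = w ->
  adj a b -> adj w v -> head b s != b -> last w t != w -> 4 <= num_detours G.
Proof.
move=> det last_r ab wv neq_b neq_w.
have def_r : b :: r = rcons (belast b r) w by rewrite lastI last_r.
have det_e : detour_seq (rev (a :: s) ++ (b :: r) ++ rcons t v) by apply: detour_seq_rotl.
have rotr s0 : detour_seq (s0 ++ (b :: r) ++ rcons t v) ->
    detour_seq (s0 ++ (b :: r) ++ rev (rcons t v)).
  by rewrite def_r !catA -[s0 ++ rcons _ _]rcons_cat => det0; apply: detour_seq_rotr.
have mem_e s0 : [set a; b] \in traced_edges (rev (a :: s) ++ (b :: r) ++ s0).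
  by rewrite rev_cons cat_rcons mem_traced_edges.
have mem_f s0 : [set w; v] \in traced_edges (s0 ++ (b :: r) ++ rev (rcons t v)).
  by rewrite def_r rev_rcons cat_rcons catA mem_traced_edges.
have notin_e s0 : detour_seq ((a :: s) ++ (b :: r) ++ s0) ->
    [set a; b] \notin traced_edges ((a :: s) ++ (b :: r) ++ s0).
  case/andP=> /andP[u _] _; apply: traced_edges_head => //.
  by case: (s) neq_b => //=; rewrite eqxx.
have notin_f s0 : detour_seq (s0 ++ (b :: r) ++ rcons t v) ->
    [set w; v] \notin traced_edges (s0 ++ (b :: r) ++ rcons t v).
  rewrite -!rcons_cat => /andP[/andP[u _] _]; apply: traced_edges_last => //.
  by rewrite !last_cat /= last_r.
by apply: (@num_detours_ge4_of_edges _ _ _ _ _ _ _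
  (notin_e _ det) (notin_f _ det) (mem_e _) (notin_f _ det_e)
  (notin_e _ (rotr _ det)) (mem_f _) (mem_e _) (mem_f _)); rewrite /all det det_e !rotr.
Qed.

(** This is the case [i >= j + 2]: [w] precedes [b], with at least the vertex [q] between them. *)
Lemma num_detours_crossing_chords a s w r q b t v :
  detour_seq ((a :: s) ++ w :: rcons r q ++ b :: rcons t v) ->
  adj a b -> adj w v -> 4 <= num_detours G.
Proof.
move=> det ab wv.
have qb : adj q b.
  by case/andP: det => /andP[_]; rewrite /= cat_path /= cat_path /= last_rcons => /and4P[_ _ _ /andP[]].
have def_det : (a :: s) ++ w :: rcons r q ++ b :: rcons t v =
    rcons (a :: s) w ++ rcons (rcons r q ++ b :: t) v.
  by rewrite -!cats1 -!catA.
pose s_e := rev ((a :: s) ++ w :: rcons r q) ++ b :: rcons t v.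
pose s_f := rcons (a :: s) w ++ rev (rcons (rcons r q ++ b :: t) v).
(* Written out, this is [t], [v], [w], [r], [q], [b], [a], [s], which uses both chords. *)
pose s_ef := rev ((q :: rev r) ++ w :: v :: rev t) ++ b :: a :: s.
have det_e : detour_seq s_e.
  by apply: detour_seq_rotl => //; rewrite -cat_cons -catA.
have det_f : detour_seq s_f.
  by apply: detour_seq_rotr => //; rewrite -def_det.
have det_ef : detour_seq s_ef.
  (* [s_ef] arises from [s_e] by a rotation along the chord [w v] and then one along [q b], the path
     edge that [s_e] had dropped. *)
  apply: detour_seq_rotl => //.
  have := @detour_seq_rotr (q :: rev r) w (rev (a :: s) ++ b :: t) v.
  move: det_e; rewrite /s_e.
  rewrite ?(rev_cat, rev_cons, rev_rcons, revK) -?cats1 -?catA /=.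
  move=> det_e /(_ det_e wv).
  by rewrite ?(rev_cat, rev_cons, rev_rcons, revK) -?cats1 -?catA /=.
have u : uniq (rcons s w ++ rcons r q ++ b :: rcons t v).
  by case/andP: det => /andP[/=/andP[_]]; rewrite -cat_rcons.
have head_neq Z : head a (rcons s w ++ Z) != b.
  have: b \notin rcons s w.
    move: u; rewrite cat_uniq => /and3P[_ /hasPn b_notin _].
    by apply: b_notin; rewrite mem_cat mem_head orbT.
  by case: (s) => [|c s'] /=; rewrite inE ?negb_or eq_sym // => /andP[].
have last_neq : last b t != w.
  move: u; rewrite cat_uniq => /and3P[_ /hasPn notin _].
  have /notin : last b t \in rcons r q ++ b :: rcons t v.
    by rewrite -rcons_cons -rcons_cat mem_rcons in_cons mem_cat mem_last !orbT.
  by apply: contraNneq => ->; rewrite mem_rcons mem_head.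
have notin_e Z : detour_seq (rcons (a :: s) w ++ Z) ->
    [set a; b] \notin traced_edges (rcons (a :: s) w ++ Z).
  by case/andP=> /andP[uZ _] _; apply: traced_edges_head.
have notin_f Z : detour_seq (Z ++ b :: rcons t v) ->
    [set w; v] \notin traced_edges (Z ++ b :: rcons t v).
  rewrite -rcons_cons -rcons_cat => /andP[/andP[uZ _] _].
  by apply: traced_edges_last; rewrite // last_cat.
apply: (@num_detours_ge4_of_edges [set a; b] [set w; v]
          ((a :: s) ++ w :: rcons r q ++ b :: rcons t v) s_e s_f s_ef).
- by rewrite /all det det_e det_f det_ef.
- by rewrite def_det notin_e // -def_det.
- by move: det; rewrite -[w :: _ ++ _]cat_cons catA; apply: notin_f.
- by rewrite /s_e cat_cons rev_cons cat_rcons mem_traced_edges.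
- exact: notin_f.
- exact: notin_e.
- by rewrite /s_f rev_rcons cat_rcons mem_traced_edges.
- by rewrite /s_ef [[set a; b]]setUC mem_traced_edges.
- rewrite /s_ef [[set w; v]]setUC rev_cat !rev_cons -!cats1 -!catA.
  exact: mem_traced_edges.
Qed.

(** * The lower bound, by the relative position of the chords *)

Lemma num_detours_ge4 : connected G -> 2 <= min_degree G -> 4 <= #|G| -> 4 <= num_detours G.
Proof.
move=> G_conn deg G_ge4.
have [s det] := detour_seq_exists.
have [a [c [s1 [b [s2 [def_s ab]]]]]] := detour_seq_chord deg (proj1 G_conn) det.
have [|v [u [t1 [w [t2 [def_rs vw]]]]]] := @detour_seq_chord (rev s) deg (proj1 G_conn).
  by rewrite detour_seq_rev.
rewrite adj_sym in vw.
have {}def_rs : s = rcons (rev t2) w ++ rcons (rcons (rev t1) u) v.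
  by rewrite -[s]revK def_rs rev_cat !rev_cons.
move: (rev t1) (rev t2) def_rs => {}t1 {}t2 def_rs.
have s_uniq : uniq s by case/andP: det => /andP[].
(* The case [i = j + 1]: rotating along [a b] gives a detour from [w] to [v], which the chord [w v]
   closes. *)
have touching : rcons t2 w = [:: a, c & s1] -> 4 <= num_detours G.
  move=> def_t2; rewrite def_s in det; have := detour_seq_rotl det ab.
  have def_s2 : b :: s2 = rcons (rcons t1 u) v.
    by move: def_rs; rewrite def_s -def_t2 => /eqP; rewrite eqseq_cat // eqxx => /eqP.
  rewrite -def_t2 rev_rcons def_s2 => /num_detours_cycle; apply=> //.
  by rewrite last_cat last_rcons adj_sym.
case: (cat_eq_cases (etrans (esym def_s) def_rs)) => -[r [def1 def2]].
  case: r def1 def2 => [|b' r] def1 def2; first by apply: touching; rewrite def1 cats0.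
  case: def2 => eq_b def2; rewrite -{b'}eq_b in def1.
  apply: (@num_detours_disjoint_chords a (c :: s1) b r w (rcons t1 u) v) => //.
  - by rewrite catA -def1 -def_rs.
  - by have := congr1 (last w) def1; rewrite last_rcons last_cat.
  - apply: contraTneq s_uniq => /= eq_cb.
    by rewrite def_s /= eq_cb mem_cat mem_head orbT !andbF.
  - rewrite last_rcons; apply: contraTneq s_uniq => eq_uw.
    rewrite def_rs eq_uw cat_uniq; apply/negP=> /and3P[_ /hasPn/(_ w)].
    by rewrite !(mem_rcons, inE) !eqxx orbT => /(_ isT).
case/lastP: r def1 def2 => [|r q] def1 def2.
  by apply: touching; rewrite def1 cats0.
(* If [s2] is empty, [b] is the last vertex and the chord [a b] closes the detour. *)
case/lastP: s2 def_s def2 => [|s2 v'] def_s def2.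
  rewrite def_s in det; apply: (num_detours_cycle G_conn G_ge4 det).
  by rewrite (last_cat a (c :: s1)) adj_sym.
have eq_v : v' = v.
  by have := congr1 (last v) def2; rewrite last_rcons last_cat /= last_rcons.
rewrite {v'}eq_v in def_s def2.
(* If [t2] is empty, [w] is the first vertex [a] and the chord [w v] closes the detour. *)
case: t2 def1 def_rs touching => [|a' t2] /= [eq_a def1] def_rs _.
  rewrite def_s in det; apply: (num_detours_cycle G_conn G_ge4 det).
  by rewrite (last_cat a (c :: s1)) /= last_rcons eq_a adj_sym.
apply: (@num_detours_crossing_chords a t2 w r q b s2 v) => //.
by rewrite def_rs def2 -eq_a cat_rcons in det.
Qed.

End Detours.

(** * The 4-cycle, which attains the bound *)

(* [next] goes once around the 4-cycle (0,0), (0,1), (1,1), (1,0). *)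
Definition next (x : bool * bool) := (x.2, ~~ x.1).

Definition C4_adj : rel (bool * bool) := [rel x y | (y == next x) || (x == next y)].

Lemma C4_adj_sym : symmetric C4_adj. Proof. by move=> x y; apply: orbC. Qed.

Lemma C4_adj_irrefl : irreflexive C4_adj. Proof. by case=> [[] []]. Qed.

Definition C4 := SGraph C4_adj_sym C4_adj_irrefl.

Lemma card_C4 : #|C4| = 4. Proof. by rewrite card_prod card_bool. Qed.

Lemma connected_C4 : connected C4.
Proof.
split=> [|x y]; first by rewrite card_C4.
have next_connect z : connect (@adj C4) z (next z) by apply/connect1/orP; left.
have iter_connect n : connect (@adj C4) x (iter n next x).
  by elim: n => //= n IH; apply: connect_trans IH (next_connect _).
have [n ->] : exists n, y = iter n next x; last exact: iter_connect.
have : y \in traject next x 4 by case: x y {iter_connect} => [[] []] [[] []].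
by case/trajectP=> n _ ->; exists n.
Qed.

Lemma min_degree_C4 : 2 <= min_degree C4.
Proof.
rewrite /min_degree; apply: (big_ind (leq 2)); first by rewrite card_C4.
  by move=> m n m2 n2; rewrite leq_min m2.
(* As [next] has order 4, its third iterate gives the predecessor of [x]. *)
move=> x _; have <- : #|[set next x; next (next (next x))]| = 2.
  by rewrite cards2; case: x => [[] []].
by apply/subset_leq_card/subsetP=> y; rewrite !inE => /orP[] /eqP->; case: x => [[] []].
Qed.

Lemma detour_order_C4 : detour_order C4 = 4.
Proof.
apply/eqP; rewrite eqn_leq; apply/andP; split.
  by apply/bigmax_leqP=> n _; rewrite -ltnS -[5]/(4.+1) -card_C4 ltn_ord.
exact: (@leq_detour_order C4 (traject next (true, true) 4)).
Qed.

(** A path through all four vertices runs around the cycle in one direction. Up to reversal it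
    follows [next], so its starting vertex determines it, and there are [#|C4|] choices. *)
Lemma num_detours_C4 : num_detours C4 <= 4.
Proof.
rewrite -card_C4 /num_detours /detours detour_order_C4.
apply: leq_trans (leq_imset_card (fun x : C4 => traced_subgraph (traject next x 4 : seq C4)) _).
apply/subset_leq_card/subsetP=> _ /imsetP[t t_path ->].
rewrite inE in t_path; case: t t_path => -[|x [|y [|z [|t []]]]] //= _ p.
have [->|->] : [:: x; y; z; t] = traject next x 4 \/
    [:: x; y; z; t] = rev (traject next t 4).
- by case: x y z t p => [[] []] [[] []] [[] []] [[] []] //=; auto.
- exact: imset_f.
- by rewrite traced_subgraph_rev; apply: imset_f.
Qed.

Theorem theorem1 :
  (forall G : sgraph,
     connected G -> 2 <= min_degree G -> 4 <= #|G| -> 4 <= num_detours G) /\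
  (exists G : sgraph,
     [/\ connected G, 2 <= min_degree G, 4 <= #|G| & num_detours G = 4]).
Proof.
split; first exact: num_detours_ge4.
have C4_ge4 : 4 <= #|C4| by rewrite card_C4.
exists C4; split=> //; [exact: connected_C4 | exact: min_degree_C4 |].
apply/eqP; rewrite eqn_leq num_detours_C4.
exact: num_detours_ge4 connected_C4 min_degree_C4 C4_ge4.
Qed.
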